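(* Let $q\ge3$ be an integer, let $\mathbb{T}_q=(V,E)$ be the $q$-regular tree endowed with counting measure and unit edge weights, let $1<p<\infty$, let $\Omega\subset V$ be a nonempty finite subset, and let $w:\Omega\to\mathbb{R}$. Assume that the Dirichlet problem $$-\Delta_p^\omega u(x)=w(x)|u(x)|^{p-2}u(x)\quad (x\in\Omega),\qquad u(x)=0\quad (x\in V\setminus\Omega)$$ admits a nontrivial solution $u\in X_V(\Omega)$ (i.e. $u\not\equiv0$). Then $$\|w_+\|_{\ell^1(\Omega,\mu)}\ge c_{p,q},\qquad\text{where } c_{p,q}=q\left(1-(q-1)^{-\frac{1}{p-1}}\right)^{p-1}.$$
   Context: The $q$-regular tree $\mathbb{T}_q=(V,E)$ is the infinite connected graph without cycles in which every vertex has degree $q$; $x\sim y$ iff $\{x,y\}\in E$. It is endowed with $\mu(x)=1$ for all $x\in V$, and $\omega_{xy}=1$ if $x\sim y$, $\omega_{xy}=0$ otherwise. $X_V(\Omega)=\{u:V\to\mathbb{R}:u=0\text{ in }V\setminus\Omega\}$. The discrete $p$-Laplacian is here $\Delta_p^\omega u(x)=\sum_{y\sim x}|u(y)-u(x)|^{p-2}(u(y)-u(x))$, with the convention $|t|^{p-2}t=0$ at $t=0$. $w_+(x)=\max\{w(x),0\}$ and $\|f\|_{\ell^1(\Omega,\mu)}=\sum_{x\in\Omega}|f(x)|$. *)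

(* Defs.v *)
From mathcomp Require Import all_boot all_order all_algebra finmap.
From mathcomp Require Import all_classical all_reals all_analysis.
Set Implicit Arguments.
Unset Strict Implicit.
Unset Printing Implicit Defensive.
Import Order.TTheory GRing.Theory Num.Theory.
Local Open Scope classical_set_scope.
Local Open Scope ring_scope.

(* [ucycle] also accepts [:: x; y] for an edge, so a graph cycle is a [ucycle]
   with at least 3 vertices. *)
Record is_regular_tree (q : nat) (V : choiceType) (e : rel V) : Prop := {
  regular_tree_sym : symmetric e;
  regular_tree_irr : irreflexive e;
  regular_tree_infinite : infinite_set [set: V];
  regular_tree_connected :
    forall x y : V, exists2 s : seq V, path e x s & last x s = y;
  regular_tree_acyclic : forall c : seq V, ucycle e c -> (size c < 3)%N;
  regular_tree_degree : forall x : V, ([set y | e x y] #= `I_q)%card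
}.

Definition X_V (R : realType) (V : choiceType) (Omega : {fset V})
  : set (V -> R) := [set u | forall x, x \notin Omega -> u x = 0].

(* |t|^(p-2) t; since [powR] is finite-valued at 0, the product is 0 at t = 0
   for every p. *)
Definition signed_pow (R : realType) (p t : R) : R := `|t| `^ (p - 2) * t.

Definition pLaplacian (R : realType) (V : choiceType) (e : rel V) (p : R)
  (u : V -> R) (x : V) : R :=
  \sum_(y \in [set y | e x y]) signed_pow p (u y - u x).

Definition dirichlet_solution (R : realType) (V : choiceType) (e : rel V)
  (p : R) (Omega : {fset V}) (w : Omega -> R) (u : V -> R) : Prop :=
  X_V Omega u /\
  forall x : Omega,
    - pLaplacian e p u (val x) = w x * signed_pow p (u (val x)).

Definition l1norm (R : realType) (V : choiceType) (Omega : {fset V})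
  (f : Omega -> R) : R := \sum_(x : Omega) `|f x|.

Definition c_pq (R : realType) (p : R) (q : nat) : R :=
  q%:R * (1 - (q%:R - 1) `^ (- (p - 1)^-1)) `^ (p - 1).

(* Main.v *)
Require Import Defs.
From mathcomp Require Import all_boot all_order all_algebra finmap.
From mathcomp Require Import all_classical all_reals all_analysis.
Import Order.TTheory GRing.Theory Num.Theory.
Local Open Scope classical_set_scope.
Local Open Scope ring_scope.

(** The theorem combines two bounds on the [p]-energy of a solution [u], that
    is, on the sum of [|u x - u y| ^ p] over the edges.

    Upper bound: multiplying the equation by [u] and summing by parts shows that
    the energy is the sum of [w x * |u x| ^ p] over [Omega], hence at most the
    norm of [w^\+] times [|u o| ^ p], where [o] is a vertex at which [|u|] is
    maximal.

    Lower bound: the energy is at least [c_pq p q * |u o| ^ p] for every finitely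
    supported [u] and every vertex [o]; in other words [c_pq p q] bounds from
    below the [p]-capacity of a vertex of the infinite tree
    ([point_capacity_ge]).  The extremal profile [r ^ d(x, o)], with
    [r = (q - 1) ^ (- 1 / (p - 1))], is [p]-harmonic off [o], and convexity
    turns it into the edge inequality ([edge_energy_ge])
      [k * (|a| ^ p - (q - 1) * |b| ^ p) <= |a - b| ^ p],  [k = (1 - r) ^ (p - 1)].
    Orient every edge away from [o] and sum this inequality with [a] the value
    at the tail and [b] the value at the head.  A vertex other than [o] is the
    tail of [q - 1] edges and the head of one, so its contributions cancel;
    [o] is the tail of [q] edges and the head of none, so exactly
    [k * q * |u o| ^ p = c_pq p q * |u o| ^ p] remains ([sum_flux]).

    The orientation comes from the uniqueness of simple paths in an acyclic
    graph ([simple_path_unique]).  Dividing the two bounds by [|u o| ^ p], which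
    is positive for a nontrivial solution, gives the claim. *)
Set Implicit Arguments.
Unset Strict Implicit.
Unset Printing Implicit Defensive.

(** * Power inequalities on the real line *)

Lemma signed_pow_mul (R : realType) (p t : R) : 0 < p ->
  signed_pow p t * t = `|t| `^ p.
Proof.
move=> p0; have [->|t0] := eqVneq t 0.
  by rewrite mulr0 normr0 powR0 // gt_eqF.
rewrite /signed_pow -mulrA -expr2 -real_normK ?num_real // -powR_mulrn //.
by rewrite -powRD ?subrK // gt_eqF.
Qed.

Lemma signed_powN (R : realType) (p t : R) : signed_pow p (- t) = - signed_pow p t.
Proof. by rewrite /signed_pow normrN mulrN. Qed.

(** Convexity of [t ^ p] applied to
    [a + b = (1 - r) * (a / (1 - r)) + r * (b / r)]; the result is multiplied by
    [(1 - r) ^ (p - 1)] so that [a ^ p] has coefficient 1. *)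
Lemma convex_powR_scaled (R : realType) (p r a b : R) :
  1 < p -> 0 < r < 1 -> 0 <= a -> 0 <= b ->
  (1 - r) `^ (p - 1) * (a + b) `^ p <=
  a `^ p + r `^ (- (p - 1)) * (1 - r) `^ (p - 1) * b `^ p.
Proof.
move=> p1 /andP[r0 r1] a0 b0.
have s0 : 0 < 1 - r by rewrite subr_gt0.
have absorb (x c : R) : 0 < x -> 0 <= c ->
    x * (c / x) `^ p = x `^ (- (p - 1)) * c `^ p.
  move=> x0 c0; have xVp : x^-1 `^ p = x `^ (- p).
    by rewrite -powR_inv1 ?ltW // -powRrM mulN1r.
  rewrite powRM ?invr_ge0 ?(ltW x0) // xVp mulrCA mulrC.
  rewrite -{1}(powRr1 (ltW x0)) -powRD ?(gt_eqF x0) ?implybT //.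
  by rewrite opprB.
have cvx : (r * (b / r) + (1 - r) * (a / (1 - r))) `^ p <=
    r * (b / r) `^ p + (1 - r) * (a / (1 - r)) `^ p.
  apply: (convex_powR (ltW p1) (Itv01 (ltW r0) (ltW r1)));
    by rewrite inE /= in_itv /= andbT; apply: divr_ge0 => //; exact: ltW.
move: cvx; rewrite !absorb // [r * _]mulrC [(1 - r) * (a / _)]mulrC.
rewrite !divfK ?gt_eqF // => cvx.
apply: (@le_trans _ _ ((1 - r) `^ (p - 1) *
    (r `^ (- (p - 1)) * b `^ p + (1 - r) `^ (- (p - 1)) * a `^ p))).
  by rewrite ler_wpM2l ?powR_ge0 // addrC.
rewrite mulrDr !mulrA -[X in _ + X * _]powRD ?(gt_eqF s0) ?implybT //.
by rewrite subrr powRr0 mul1r addrC [(1 - r) `^ _ * _]mulrC.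
Qed.

(** The choice [r = (q - 1) ^ (- 1 / (p - 1))] makes the factor [r ^ (1 - p)] of
    [convex_powR_scaled] equal to [q - 1], the number of edges that leave the
    head [b] of the edge: this is what makes the sum over the tree telescope. *)
Lemma edge_energy_ge (R : realType) (q : nat) (p a b : R) :
  (3 <= q)%N -> 1 < p ->
  (1 - (q%:R - 1) `^ (- (p - 1)^-1)) `^ (p - 1) *
    (`|a| `^ p - (q%:R - 1) * `|b| `^ p) <= `|a - b| `^ p.
Proof.
move=> q3 p1; set r := _ `^ (- _).
have p10 : 0 < p - 1 by rewrite subr_gt0.
have q1 : 1 < q%:R - 1 :> R.
  by rewrite ltrBrDr (_ : 1 + 1 = 2%:R) ?ltr_nat.
have q0 : 0 < q%:R - 1 :> R by exact: lt_trans q1.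
have r0 : 0 < r by rewrite powR_gt0.
have r1 : r < 1.
  rewrite /r powRN invf_lt1 ?powR_gt0 //.
  have := @gt0_ltr_powR R (p - 1)^-1 _ 1 (q%:R - 1).
  by rewrite powR1 invr_gt0 !nnegrE (ltW q0) p10 ler01; apply.
have rE : r `^ (- (p - 1)) = q%:R - 1.
  by rewrite /r -powRrM mulrNN mulVf ?gt_eqF // powRr1 // ltW.
have := @convex_powR_scaled R p r `|a - b| `|b| p1.
rewrite r0 r1 !normr_ge0 rE => /(_ isT isT isT) cvx.
rewrite mulrBr lerBlDr mulrA [(1 - r) `^ _ * (_ - _)]mulrC.
apply: le_trans cvx; rewrite ler_wpM2l ?powR_ge0 //.
apply: ge0_ler_powR; rewrite ?nnegrE ?addr_ge0 //.
  by rewrite (le_trans _ (ltW p1)).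
by rewrite -{1}[a](subrK b) ler_normD.
Qed.

(** * Orienting the edges of a tree away from a root *)

(** If two simple paths from [x] diverge at their first steps [a] and [b], then
    following one to the common end and the other one back joins [a] to [b]
    without meeting [x]; shortened to a simple path and closed up through [x],
    this is a cycle. *)
Lemma simple_path_unique (V : eqType) (e : rel V) (x : V) (s t : seq V) :
  symmetric e -> (forall c, ucycle e c -> (size c < 3)%N) ->
  path e x s -> uniq (x :: s) -> path e x t -> uniq (x :: t) ->
  last x s = last x t -> s = t.
Proof.
move=> e_sym acyclic.
elim: s x t => [|a s IHs] x [|b t] //=.
- by move=> _ _ _ /andP[/negP xNt _] xE; case: xNt; rewrite xE mem_last.
- by move=> _ /andP[/negP xNs _] _ _ xE; case: xNs; rewrite -xE mem_last.
move=> /andP[exa ps] /andP[xNs us] /andP[exb pt] /andP[xNt ut] lastE.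
have [ab|aNb] := eqVneq a b.
  by rewrite ab in ps us lastE *; rewrite (IHs _ _ ps us pt ut lastE).
(* Paths in [e'] are the paths in [e] that avoid [x]. *)
pose e' := [rel y z | [&& e y z, y != x & z != x]].
have avoids c r : x \notin c :: r -> path e c r -> path e' c r.
  elim: r c => //= d r IHr c; rewrite inE negb_or => /andP[xNc xNr].
  move=> /andP[-> pr]; rewrite (eq_sym c) xNc IHr //= andbT.
  by move: xNr; rewrite inE negb_or eq_sym => /andP[].
have e'_sym : symmetric e' by move=> y z /=; rewrite e_sym [X in _ && X]andbC.
have pback : path e' (last a s) (rev (belast b t)).
  rewrite lastE rev_path (eq_path (e' := e')); first exact: avoids.
  by move=> y z; exact: e'_sym.
have pab : path e' a (s ++ rev (belast b t)).
  by rewrite cat_path pback avoids.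
have lab : last a (s ++ rev (belast b t)) = b.
  rewrite last_cat lastE; case: (t) => //= d t'.
  by rewrite rev_cons last_rcons.
case/shortenP: pab lab => r pr ur _ rE.
have e'P c r' : c != x -> path e' c r' -> path e c r' && (x \notin c :: r').
  elim: r' c => [|d r' IHr] c cNx /=; first by rewrite inE eq_sym cNx.
  move=> /andP[/and3P[-> _ dNx] /(IHr _ dNx) /andP[-> xNr]] /=.
  by rewrite inE negb_or eq_sym cNx.
have aNx : a != x by apply: contraNneq xNs => ->; rewrite mem_head.
have /andP[per xNr] := e'P _ _ aNx pr.
have /acyclic : ucycle e (x :: a :: r).
  rewrite /ucycle /= rcons_path exa per rE e_sym exb xNr /=.
  by move: ur.
case: (r) rE aNb => [/= -> /eqP|c r'] //.
Qed.

(** The edge from [x] to [y] points away from [o] when it is the last step of a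
    simple path from [o]; this makes [x] the parent of [y] without any reference
    to the distance from [o]. *)
Definition points_away (V : choiceType) (e : rel V) (o x y : V) : bool :=
  `[< exists s, [/\ path e o (rcons s y), uniq (o :: rcons s y) & last o s = x] >].

Section Tree.
Context (q : nat) (V : choiceType) (e : rel V) (htree : is_regular_tree q e).
Context (o : V).
Local Notation away := (points_away e o).

Lemma away_edge x y : away x y -> e x y.
Proof. by case/asboolP => s [+ _ <-]; rewrite rcons_path => /andP[]. Qed.

Lemma away_root x : away x o = false.
Proof. by apply/asboolP => -[s []]; rewrite /= mem_rcons mem_head. Qed.

Lemma away_parent_unique x x' y : away x y -> away x' y -> x = x'.
Proof.
move=> /asboolP[s [ps us <-]] /asboolP[s' [ps' us' <-]].
have : rcons s y = rcons s' y.
  apply: (simple_path_unique (regular_tree_sym htree)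
    (@regular_tree_acyclic _ _ _ htree) ps us ps' us').
  by rewrite !last_rcons.
by move/rcons_inj => [->].
Qed.

Lemma simple_path_exists x :
  exists s, [/\ path e o s, uniq (o :: s) & last o s = x].
Proof.
have [s ps lE] := regular_tree_connected htree o x.
by case/shortenP: ps lE => r pr ur _ rE; exists r.
Qed.

Lemma away_parent y : y != o -> exists x, away x y.
Proof.
have [s [ps us <-]] := simple_path_exists y.
case: s / (lastP s) ps us => [|s z] ps us; first by rewrite eqxx.
by rewrite last_rcons => _; exists (last o s); apply/asboolP; exists s.
Qed.

(** Take the simple path from [o] to [x].  If it avoids [y], it extends to a
    simple path to [y].  If it meets [y], its part after [y] together with the
    edge back to [y] would be a cycle unless it is the single step to [x].  Both
    cannot hold, since then each of two paths would be one step longer than the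
    other. *)
Lemma edge_away x y : e x y = away x y (+) away y x.
Proof.
have e_sym := regular_tree_sym htree.
have sp_uniq := simple_path_unique e_sym (@regular_tree_acyclic _ _ _ htree).
have exclusive : away x y -> away y x -> False.
  move=> /asboolP[s [ps us sE]] /asboolP[t [pt ut tE]].
  have sE' : s = rcons t x.
    apply: (sp_uniq o) => //; last by rewrite last_rcons.
      by move: ps; rewrite rcons_path => /andP[].
    by move: us; rewrite -rcons_cons rcons_uniq => /andP[].
  have tE' : t = rcons s y.
    apply: (sp_uniq o) => //; last by rewrite last_rcons.
      by move: pt; rewrite rcons_path => /andP[].
    by move: ut; rewrite -rcons_cons rcons_uniq => /andP[].
  move/(congr1 size): sE'; rewrite tE' !size_rcons => /eqP.
  by rewrite -addn2 -{1}[size s]addn0 eqn_add2l.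
apply/idP/idP; last first.
  case: (boolP (away x y)) => [/away_edge-> //|_] /=.
  by move/away_edge; rewrite e_sym.
move=> exy.
suff : away x y \/ away y x.
  case=> h; rewrite h ?addbT //=; apply/negP => h'; exact: exclusive.
have [s [ps us sE]] := simple_path_exists x.
have [yos|yNos] := boolP (y \in o :: s); last first.
  left; apply/asboolP; exists s; split=> //.
    by rewrite rcons_path ps sE.
  by rewrite -rcons_cons rcons_uniq yNos.
right.
case/splitPl: yos ps us sE => s1 s2 s1E.
rewrite cat_path s1E last_cat s1E -cat_cons cat_uniq => /andP[ps1 ps2] us sE.
have [us1 /hasPn s12 us2] := and3P us.
have ys2 : y \notin s2.
  by apply/negP => /s12; rewrite -s1E mem_last.
have /(regular_tree_acyclic htree) : ucycle e (y :: s2).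
  by rewrite /ucycle /= rcons_path ps2 sE exy ys2.
case: s2 ps2 us s12 us2 sE ys2 => [|z [|z' s2]] //=.
  by move=> _ _ _ _ yx; rewrite yx (regular_tree_irr htree) in exy.
move=> /andP[eyz _] us _ _ zx _ _; subst z.
apply/asboolP; exists s1; split=> //; first by rewrite rcons_path ps1 s1E.
rewrite -rcons_cons rcons_uniq us1 andbT.
by case/and3P: us => _; rewrite orbF.
Qed.

Local Notation N x := (fset_set [set y | e x y]).

Lemma neighbours_finite x : finite_set [set y | e x y].
Proof. by apply/finite_setP; exists q; exact: regular_tree_degree htree x. Qed.

Lemma in_neighbours x y : (y \in N x) = e x y.
Proof.
rewrite in_fset_set; first by apply/idP/idP; rewrite inE.
exact: neighbours_finite.
Qed.

Lemma count_parents x : count (away^~ x) (N x) = (x != o).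
Proof.
have [->|/away_parent[z zx]] := eqVneq x o.
  by rewrite (eq_count (a2 := pred0)) ?count_pred0 // => y; rewrite /= away_root.
rewrite (eq_count (a2 := pred1 z)).
  rewrite count_uniq_mem ?fset_uniq // in_neighbours.
  by rewrite (regular_tree_sym htree) (away_edge zx).
move=> y; apply/idP/eqP => [yx|->//]; exact: away_parent_unique yx zx.
Qed.

Lemma count_children x : (count (away x) (N x) + (x != o) = q)%N.
Proof.
rewrite -count_parents -(card_fset_set (regular_tree_degree htree x)).
rewrite -count_predUI addnC [X in (X + _)%N](eq_in_count (a2 := pred0)).
  rewrite count_pred0 add0n; apply/eqP; rewrite -all_count; apply/allP => y.
  by rewrite in_neighbours edge_away /=; case: (away x y) (away y x) => [] [].
move=> y; rewrite in_neighbours edge_away /=.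
by case: (away x y) (away y x) => [] [].
Qed.

(** * Sums over the oriented edges *)

(** Used to sum over pairs of a fixed finite set [B], where the two vertices can
    be exchanged, although the [p]-Laplacian sums over neighbours. *)
Lemma sum_neighbours (R : realType) (B : {fset V}) x (P : pred V) (F : V -> R) :
  (forall y, e x y -> y \in B) ->
  \sum_(y <- B | e x y && P y) F y = \sum_(y <- N x | P y) F y.
Proof.
move=> NB; rewrite -big_filter -[RHS]big_filter; apply: perm_big.
apply: uniq_perm; rewrite ?filter_uniq ?fset_uniq // => y.
rewrite !mem_filter in_neighbours.
by have [/NB->|_] := boolP (e x y); rewrite ?andbT ?andbF.
Qed.

Lemma sum_edges_away (R : realType) (B : {fset V}) (F : V -> V -> R) :
  \sum_(x <- B) \sum_(y <- B | e x y) F x y =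
  \sum_(x <- B) \sum_(y <- B | away x y) (F x y + F y x).
Proof.
transitivity (\sum_(x <- B) (\sum_(y <- B | away x y) F x y +
                             \sum_(y <- B | away y x) F x y)).
  apply: eq_bigr => x _.
  rewrite big_mkcond [X in _ = X + _]big_mkcond [X in _ = _ + X]big_mkcond.
  rewrite -big_split; apply: eq_bigr => y _ /=; rewrite edge_away.
  have := edge_away x y.
  case: (boolP (away x y)) => [xy|_]; case: (boolP (away y x)) => [yx|_] /=.
  - by rewrite (away_edge xy).
  - by rewrite addr0.
  - by rewrite add0r.
  - by rewrite addr0.
rewrite big_split /= [X in _ + X = _](exchange_big_dep xpredT) //= -big_split /=.
by apply: eq_bigr => x _; rewrite -big_split.
Qed.

(** The telescoping step: the term [g x] is counted once for each child of [x]
    and [(q - 1) * g x] is subtracted once for its parent, so that only the root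
    contributes.  The set [B] must contain the support of [g] and all its
    neighbours for these counts to be complete. *)
Lemma sum_flux (R : realType) (B : {fset V}) (g : V -> R) :
  o \in B ->
  (forall x, g x != 0 -> x \in B /\ forall y, e x y -> y \in B) ->
  \sum_(x <- B) \sum_(y <- B | away x y) (g x - (q%:R - 1) * g y) =
  q%:R * g o.
Proof.
move=> oB gB.
under eq_bigr do rewrite big_split /= sumrN.
rewrite big_split /= sumrN [X in _ - X](exchange_big_dep xpredT) //= -sumrB.
transitivity (\sum_(x <- B) (if x == o then q%:R * g o else 0)).
  apply: eq_bigr => x _.
  have [gx0|/gB[_ NB]] := eqVneq (g x) 0.
    rewrite gx0 !big1 ?subr0 //; first by case: eqP => [<-|//]; rewrite gx0 mulr0.
    by move=> *; rewrite mulr0.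
  rewrite (eq_bigl (fun y => e x y && away x y)); last first.
    by move=> y; rewrite andb_idl // => /away_edge.
  rewrite [X in _ - X](eq_bigl (fun y => e x y && away y x)); last first.
    by move=> y; rewrite andb_idl // (regular_tree_sym htree) => /away_edge.
  rewrite !sum_neighbours // !big_const_seq !iter_addr_0.
  rewrite count_parents -[in X in _ - X](count_children x) -[in RHS](count_children x).
  case: eqP => [->|_] /=; first by rewrite addn0 mulr0n subr0 mulr_natl.
  by rewrite mulr1n addn1 -natr1 addrK mulr_natl subrr.
rewrite (big_fsetD1 o) //= eqxx big_seq big1 ?addr0 // => x.
by rewrite !inE => /andP[/negbTE->].
Qed.

End Tree.

(** * Energy of a finitely supported function *)

Lemma pLaplacianE (R : realType) (q : nat) (V : choiceType) (e : rel V) (p : R)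
  (u : V -> R) (x : V) :
  is_regular_tree q e ->
  - pLaplacian e p u x =
  \sum_(y <- fset_set [set y | e x y]) signed_pow p (u x - u y).
Proof.
move=> htree; rewrite /pLaplacian fsbig_finite; last exact: neighbours_finite htree x.
by rewrite -sumrN; apply: eq_bigr => y _ /=; rewrite -signed_powN opprB.
Qed.

(** The right-hand side is the energy of [u], summed by parts: [phi = signed_pow p]
    is odd, so the terms [phi (u x - u y) * u x] of the two orientations of an
    edge add up to [phi (u x - u y) * (u x - u y) = |u x - u y| ^ p], to which
    the edge inequality applies.  The sums range over [Omega] together with its
    neighbours, which includes every edge on which [u] is not constant. *)
Lemma point_capacity_ge (R : realType) (q : nat) (V : choiceType) (e : rel V)
  (p : R) (Omega : {fset V}) (u : V -> R) (o : V) :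
  is_regular_tree q e -> (3 <= q)%N -> 1 < p -> X_V Omega u -> o \in Omega ->
  c_pq p q * `|u o| `^ p <= \sum_(x <- Omega) u x * - pLaplacian e p u x.
Proof.
move=> htree q3 p1 u0 oO; have p0 : 0 < p by exact: lt_trans p1.
pose B := (Omega `|` \bigcup_(x <- Omega) fset_set [set y | e x y])%fset.
have OB x : x \in Omega -> x \in B by move=> xO; rewrite inE xO.
have NB x y : x \in Omega -> e x y -> y \in B.
  move=> xO exy; rewrite inE; apply/orP; right; apply/bigfcupP.
  by exists x; rewrite ?xO // (in_neighbours htree).
have supp x : u x != 0 -> x \in Omega.
  by move=> ux; apply: contraNT ux => /u0->.
have -> : \sum_(x <- Omega) u x * - pLaplacian e p u x =
    \sum_(x <- B) \sum_(y <- B | e x y) u x * signed_pow p (u x - u y).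
  rewrite -[RHS](big_fset_incl _ (fsubsetUl Omega _)) => [|x _ /u0 ->].
    rewrite big_seq [RHS]big_seq; apply: eq_bigr => x xO.
    rewrite (pLaplacianE _ _ _ htree) -mulr_sumr; congr (_ * _).
    rewrite -(sum_neighbours htree (B := B) xpredT) => [|y]; last exact: NB.
    by apply: eq_bigl => y; rewrite andbT.
  by rewrite big1 // => y _; rewrite mul0r.
apply: le_trans (_ : \sum_(x <- B) \sum_(y <- B | points_away e o x y)
   (1 - (q%:R - 1) `^ (- (p - 1)^-1)) `^ (p - 1) *
    (`|u x| `^ p - (q%:R - 1) * `|u y| `^ p) <= _).
  under eq_bigr do rewrite -mulr_sumr.
  rewrite -mulr_sumr (sum_flux htree (g := fun x => `|u x| `^ p)).
  - by rewrite mulrA [X in X * _]mulrC.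
  - exact: OB.
  - move=> x; have [->|/supp xO _] := eqVneq (u x) 0.
      by rewrite normr0 powR0 ?eqxx // gt_eqF.
    by split; [exact: OB|move=> y; exact: NB].
rewrite (sum_edges_away htree o); apply: ler_sum => x _; apply: ler_sum => y _.
apply: le_trans (edge_energy_ge _ _ q3 p1) _.
by rewrite -signed_pow_mul // -(opprB (u x)) signed_powN mulrN -mulNr -mulrDl mulrC.
Qed.

(** * The lower bound on the weight *)

Unset Implicit Arguments.

Theorem theorem3p17 (R : realType) (q : nat) (hq : (3 <= q)%N)
  (V : choiceType) (e : rel V) (htree : is_regular_tree q e)
  (p : R) (hp : 1 < p)
  (Omega : {fset V}) (hOmega : Omega != fset0)
  (w : Omega -> R)
  (hsol : exists u : V -> R,
    dirichlet_solution e p w u /\ exists x : V, u x != 0) :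
  c_pq p q <= l1norm (w^\+).
Proof.
have [u [[u0 sol] [x ux]]] := hsol.
have xO : x \in Omega by apply: contraNT ux => /u0->.
have [m umax] : exists m : Omega, forall y : Omega, `|u (val y)| <= `|u (val m)|.
  case: (arg_maxP (P := xpredT) (i0 := [`xO]%fset)
    (fun y : Omega => `|u (val y)|)) => // m _ umax.
  by exists m => y; exact: umax.
have p0 : 0 < p by exact: lt_trans hp.
have uo : 0 < `|u (val m)| `^ p.
  by rewrite powR_gt0 // (lt_le_trans _ (umax [`xO]%fset)) // normr_gt0.
rewrite -(ler_pM2r uo).
apply: le_trans (point_capacity_ge htree hq hp u0 (valP m)) _.
rewrite big_seq_fsetE /l1norm mulr_suml; apply: ler_sum => y _.
rewrite sol mulrCA [u _ * _]mulrC signed_pow_mul //.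
apply: le_trans (_ : (w^\+ y) * `|u (val y)| `^ p <= _).
  by rewrite ler_wpM2r ?powR_ge0 // /funrpos /= le_max lexx.
apply: ler_pM (powR_ge0 _ _) (ler_norm _) _ => //.
by apply: ge0_ler_powR; rewrite ?nnegrE ?(ltW p0) ?umax.
Qed.
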